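(* Let $d\ge 1$, let $\gamma,p\in\mathbb{R}$ with $\gamma+2p\ge 1$, let $0<c_1\le c_2<\infty$, and let $\Phi(s)=s^{-p}(1-s)^{-p}$ for $0<s<1$. The following hold. (i) Suppose that $K:\mathbb{R}^d_*\times\mathbb{R}^d_*\to\mathbb{R}_+$ is a continuous symmetric function satisfying $$c_1(|x|+|y|)^{\gamma}\,\Phi\!\left(\tfrac{|x|}{|x|+|y|}\right)\le K(x,y)\le c_2(|x|+|y|)^{\gamma}\,\Phi\!\left(\tfrac{|x|}{|x|+|y|}\right),\qquad x,y\in\mathbb{R}^d_*.$$ Suppose that $\eta\in\mathcal{M}_{+,b}(\mathbb{R}^d_* )$, $\eta\neq 0$, is supported inside the set $\{x\in\mathbb{R}^d_*:1\le|x|\le L\}$ for some $L>1$. Then there is no stationary injection solution with kernel $K$, parameters $(\gamma,p)$ and source $\eta$. (ii) Suppose that $K:\mathbb{N}^d_*\times\mathbb{N}^d_*\to\mathbb{R}_+$, $(\alpha,\beta)\mapsto K_{\alpha,\beta}$, is symmetric and satisfies $$c_1(|\alpha|+|\beta|)^{\gamma}\,\Phi\!\left(\tfrac{|\alpha|}{|\alpha|+|\beta|}\right)\le K_{\alpha,\beta}\le c_2(|\alpha|+|\beta|)^{\gamma}\,\Phi\!\left(\tfrac{|\alpha|}{|\alpha|+|\beta|}\right),\qquad \alpha,\beta\in\mathbb{N}^d_*.$$ Let $\{s_\alpha\}_{\alpha\in\mathbb{N}^d_*}$ be a non-negative sequence supported on a finite number of values $\alpha$, with $\sum_\alpha s_\alpha>0$.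 Then there is no discrete stationary injection solution with kernel $K$, parameters $(\gamma,p)$ and source $\{s_\alpha\}$.
   Context: Notation: $\mathbb{R}_+=[0,\infty)$, $\mathbb{N}_0=\{0,1,2,\dots\}$, $O=(0,\dots,0)$, $\mathbb{R}^d_*=\mathbb{R}_+^d\setminus\{O\}$, $\mathbb{N}^d_*=\mathbb{N}_0^d\setminus\{O\}$, and $|x|=\sum_{j=1}^d x_j$ is the $\ell^1$-norm. $\mathcal{M}_+(X)$ denotes the non-negative Radon measures on $X$ (not necessarily bounded) and $\mathcal{M}_{+,b}(X)$ the bounded ones. $C^1_c(\mathbb{R}^d_* )$ denotes the $C^1$ functions with compact support in $\mathbb{R}^d_*$. Definition (stationary injection solution with kernel $K$, parameters $(\gamma,p)$, source $\eta$). A measure $f\in\mathcal{M}_+(\mathbb{R}^d_* )$ is a stationary injection solution if the support of $f$ is contained in $\{x\in\mathbb{R}^d_*:|x|\ge 1\}$, $\int_{\mathbb{R}^d_*}|x|^{\gamma+p}f(dx)<\infty$, and for every $\varphi\in C^1_c(\mathbb{R}^d_* )$ $$0=\frac12\int_{\mathbb{R}^d_*}\int_{\mathbb{R}^d_*}K(x,y)\,[\varphi(x+y)-\varphi(x)-\varphi(y)]\,f(dx)f(dy)+\int_{\mathbb{R}^d_*}\varphi(x)\,\eta(dx).$$ Definition (discrete stationary injection solution with kernel $K$, parameters $(\gamma,p)$, source $\{s_\alpha\}$). This is a sequence $\{n_\alpha\}_{\alpha\in\mathbb{N}^d_*}$ with $n_\alpha\ge 0$, $\sum_{\alpha}|\alpha|^{\gamma+p}n_\alpha<\infty$,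 and such that $f=\sum_\alpha n_\alpha\delta(\cdot-\alpha)$ solves the weak equation with source $\eta=\sum_\alpha s_\alpha\delta(\cdot-\alpha)$, i.e. for every $\varphi\in C^1_c(\mathbb{R}^d_* )$ $$0=\frac12\sum_{\alpha\in\mathbb{N}^d_*}\sum_{\beta\in\mathbb{N}^d_*}K_{\alpha,\beta}\,[\varphi(\alpha+\beta)-\varphi(\alpha)-\varphi(\beta)]\,n_\alpha n_\beta+\sum_{\alpha\in\mathbb{N}^d_*}\varphi(\alpha)s_\alpha .$$ *)

(* Defs.v *)
From HB Require Import structures.
From mathcomp Require Import all_boot all_order all_algebra.
From mathcomp Require Import all_classical all_reals all_analysis.

Set Implicit Arguments.
Unset Strict Implicit.
Unset Printing Implicit Defensive.

Import Order.TTheory GRing.Theory Num.Theory.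
Import numFieldNormedType.Exports.

Local Open Scope classical_set_scope.
Local Open Scope ring_scope.

Definition Rstar (R : realType) (d : nat) : set 'rV[R]_d :=
  [set x | (forall j, 0 <= x ord0 j) /\ x != 0].

Definition Nstar (d : nat) : set 'rV[nat]_d := [set a | a != 0].

(* No absolute values: this is the l^1-norm only on vectors with non-negative
   entries, the only ones it is used for. *)
Definition l1 (R : realType) (d : nat) (x : 'rV[R]_d) : R := \sum_j x ord0 j.

Definition toR (R : realType) (d : nat) (a : 'rV[nat]_d) : 'rV[R]_d :=
  map_mx (fun k : nat => k%:R) a.

Definition Phi (R : realType) (p s : R) : R := s `^ (- p) * (1 - s) `^ (- p).

(* (s + t)^gamma * Phi(s / (s + t)), to be used with s = |x| and t = |y|. *)
Definition kernel_ref (R : realType) (gamma p s t : R) : R :=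
  (s + t) `^ gamma * Phi p (s / (s + t)).

(* R^d with its Borel sigma-algebra. *)
Definition borelRd (R : realType) (d : nat) :=
  g_sigma_algebraType (@open 'rV[R]_d).

(* A measure on R^d_* is encoded as a Borel measure on R^d for which the
   complement of R^d_* is null. It need not be finite near the origin. *)
Definition radon_on_Rstar (R : realType) (d : nat)
    (mu : {measure set (borelRd R d) -> \bar R}) : Prop :=
  [/\ mu (~` @Rstar R d) = 0%E,
      forall C : set 'rV[R]_d, compact C -> C `<=` @Rstar R d ->
        (mu C < +oo)%E
    & forall A : set (borelRd R d), measurable A -> A `<=` @Rstar R d ->
        mu A = ereal_sup
          [set mu C | C in [set C : set 'rV[R]_d | compact C /\ C `<=` A]]].

Definition bounded_radon_on_Rstar (R : realType) (d : nat)
    (mu : {measure set (borelRd R d) -> \bar R}) : Prop :=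
  radon_on_Rstar mu /\ (mu setT < +oo)%E.

(* Topological support in R^d_*. Since mu does not charge the complement of
   R^d_*, open sets of R^d may be used instead of relatively open ones. *)
Definition msupport (R : realType) (d : nat)
    (mu : {measure set (borelRd R d) -> \bar R}) : set 'rV[R]_d :=
  [set x | @Rstar R d x /\
           forall U : set 'rV[R]_d, open U -> U x -> (0 < mu U)%E].

(* Since R^d_* is not open, C^1 means that phi is given by a
   function that is C^1 on an open neighbourhood of R^d_*; the values of phi
   outside R^d_* are never used. The support is the closed support relative to
   R^d_*: its compactness keeps it away from the origin, but it may meet the
   faces x_j = 0. *)
Definition C1c (R : realType) (d : nat) (phi : 'rV[R]_d -> R) : Prop :=
  (exists U : set 'rV[R]_d,
     [/\ open U, @Rstar R d `<=` U,
         forall x, U x -> differentiable phi x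
       & forall v x, U x -> {for x, continuous ('D_v phi)}]) /\
  compact (@Rstar R d `&`
           closure (@Rstar R d `&` [set x | phi x != 0])).

Definition stationary_injection_solution (R : realType) (d : nat)
    (K : 'rV[R]_d -> 'rV[R]_d -> R) (gamma p : R)
    (eta f : {measure set (borelRd R d) -> \bar R}) : Prop :=
  [/\ radon_on_Rstar f,
      msupport f `<=` [set x | 1 <= l1 x],
      (\int[f]_(x in @Rstar R d) ((l1 x) `^ (gamma + p))%:E < +oo)%E
    & forall phi : 'rV[R]_d -> R, C1c phi ->
        (0 = 2^-1%:E *
             (\int[f]_(y in @Rstar R d) \int[f]_(x in @Rstar R d)
                (K x y * (phi (x + y) - phi x - phi y))%:E)
           + \int[eta]_(x in @Rstar R d) (phi x)%:E)%E].

(* Sum of a family with arbitrary signs ([esum] is meant for non-negative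
   families only): the sum of the positive parts minus that of the negative
   parts, as for the Lebesgue integral against the counting measure. *)
Definition signed_esum (R : realType) (T : choiceType) (D : set T)
    (a : T -> \bar R) : \bar R :=
  (esum D a^\+ - esum D a^\-)%E.

Definition discrete_stationary_injection_solution (R : realType) (d : nat)
    (K : 'rV[nat]_d -> 'rV[nat]_d -> R) (gamma p : R)
    (s n : 'rV[nat]_d -> R) : Prop :=
  [/\ forall a, Nstar a -> 0 <= n a,
      (\esum_(a in @Nstar d) ((l1 (toR R a)) `^ (gamma + p) * n a)%:E < +oo)%E
    & forall phi : 'rV[R]_d -> R, C1c phi ->
        (0 = 2^-1%:E *
             signed_esum (@Nstar d) (fun a => signed_esum (@Nstar d) (fun b =>
               (K a b * (phi (toR R (a + b)) - phi (toR R a) - phi (toR R b))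
                * n a * n b)%:E))
           + signed_esum (@Nstar d) (fun a => (phi (toR R a) * s a)%:E))%E].

(* Main.v *)
(* Test the equation with phi(x) = g(|x|), where g is C^1, g(s) = s for
   1 <= s <= 2 rho, g vanishes near 0 and for large s, and g is Lipschitz on
   [1, oo[ uniformly in rho. For s, t >= 1 the increment g(s + t) - g(s) - g(t)
   vanishes when s + t <= 2 rho and is at most 3 min(s, t) in general. With
   a = gamma + p and gamma + 2 p >= 1, the upper bound on K then yields
     K(x, y) |phi(x + y) - phi(x) - phi(y)|
       <= C |x|^a |y|^a (1_{|x| > rho} + 1_{|y| > rho}),
   so the collision term is at most 2 C M E(rho), where M is the moment of order
   a of the solution and E(rho), its part over |x| > rho, tends to 0. The source
   term stays above a positive constant once 2 rho >= L: a contradiction. *)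
Require Import Defs.
From HB Require Import structures.
From mathcomp Require Import all_boot all_order all_algebra.
From mathcomp Require Import all_classical all_reals all_analysis.
From mathcomp Require Import measurable_realfun finmap ring lra.
Import Order.TTheory GRing.Theory Num.Theory.
Import numFieldNormedType.Exports.
Local Open Scope classical_set_scope.
Local Open Scope ring_scope.

(** * The truncated identity [trunc_id] and its growth *)

(** The truncated power of degree 2, which is C^1 across its knot [c]: combinations of its
    translates are C^1 quadratic splines. *)
Definition sqpos {R : realType} (c s : R) : R := Num.max 0 (s - c) ^+ 2.

Lemma is_derive_sqpos {R : realType} (c s : R) :
  is_derive s 1 (sqpos c) (2 * Num.max 0 (s - c)).
Proof.
(* The first-order remainder is at most [h ^+ 2] whatever the position of [s] and [h + s] relative
   to [c]; after division by [h] the error is at most [|h|]. *)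
have quot (h : R) :
    `|sqpos c (h + s) - sqpos c s - h * (2 * Num.max 0 (s - c))| <= h ^+ 2.
  rewrite /sqpos ler_norml.
  have [H|H] := lerP 0 (h + s - c); have [H'|H'] := lerP 0 (s - c);
    apply/andP; split; nra.
have cv : h^-1 *: ((sqpos c \o shift s) (h *: 1) - sqpos c s) @[h --> 0^'] -->
    2 * Num.max 0 (s - c).
  apply/cvgrPdist_le => e e0; near=> h.
  have h0 : h != 0 by near: h; exact: nbhs_dnbhs_neq.
  have he : `|h| <= e.
    near: h; apply: dnbhs0_le => //.
  rewrite distrC /= /GRing.scale /= mulr1.
  rewrite -(ler_pM2l (_ : 0 < `|h|)) ?normr_gt0// -normrM.
  rewrite mulrBr mulrA divff// mul1r.
  apply: le_trans (quot h) _.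
  by rewrite -(real_normK (num_real h)) expr2 ler_wpM2l.
apply: DeriveDef; first by apply/cvg_ex; eexists; exact: cv.
exact/cvg_lim.
Unshelve. all: by end_near. Qed.

(* The C^1 quadratic spline with derivative 0, 5/2, 1, 1, -3/2, 0 at the knots
   1/3, 2/3, 1, r, 2 r, 3 r. *)
Definition trunc_id {R : realType} (r s : R) : R :=
  15 / 4 * sqpos (1 / 3) s - 6 * sqpos (2 / 3) s + 9 / 4 * sqpos 1 s
  + r^-1 * (- (5 / 4) * sqpos r s + 2 * sqpos (2 * r) s
            - 3 / 4 * sqpos (3 * r) s).

Definition trunc_id' {R : realType} (r s : R) : R :=
  15 / 2 * Num.max 0 (s - 1 / 3) - 12 * Num.max 0 (s - 2 / 3)
  + 9 / 2 * Num.max 0 (s - 1)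
  + r^-1 * (- (5 / 2) * Num.max 0 (s - r) + 4 * Num.max 0 (s - 2 * r)
            - 3 / 2 * Num.max 0 (s - 3 * r)).

Lemma is_derive_trunc_id {R : realType} (r s : R) :
  is_derive s 1 (trunc_id r) (trunc_id' r s).
Proof.
have D c := is_derive_sqpos c s.
have -> : trunc_id r = (15 / 4) *: sqpos (1 / 3) - 6 *: sqpos (2 / 3)
  + (9 / 4) *: sqpos 1
  + r^-1 *: ((- (5 / 4)) *: sqpos r + 2 *: sqpos (2 * r)
            - (3 / 4) *: sqpos (3 * r)) by [].
have DZ k c : is_derive s 1 (k *: sqpos c) (k * (2 * Num.max 0 (s - c))).
  exact: is_deriveZ.
apply: (@is_derive_eq _ _ _ _ _ _ _ _ (is_deriveD (is_deriveD (is_deriveB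
  (DZ (15 / 4) (1 / 3)) (DZ 6 (2 / 3))) (DZ (9 / 4) 1)) (is_deriveZ r^-1
  (is_deriveB (is_deriveD (DZ (- (5 / 4)) r) (DZ 2 (2 * r)))
     (DZ (3 / 4) (3 * r)))))).
rewrite /trunc_id' /GRing.scale /=.
move: (Num.max _ _) (Num.max _ _) (Num.max _ _) (Num.max _ _) (Num.max _ _)
  (Num.max _ _) (r^-1) => a b c d e f i.
by field.
Qed.

Lemma continuous_max0 {R : realType} (c : R) :
  continuous (fun s : R => Num.max 0 (s - c)).
Proof.
move=> s; apply: (@continuous_max _ _ (cst 0) (fun s => s - c)); first exact: cvg_cst.
by apply: cvgB; [exact: cvg_id|exact: cvg_cst].
Qed.

Lemma continuous_trunc_id' {R : realType} (r : R) : continuous (trunc_id' r).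
Proof.
move=> s; rewrite /trunc_id'.
have C k c : {for s, continuous (fun x : R => k * Num.max 0 (x - c))}.
  by apply: (@cvgM _ _ _ _ (cst k)); [exact: cvg_cst|exact: continuous_max0].
exact: (cvgD (cvgD (cvgB (C (15 / 2) (1 / 3)) (C 12 (2 / 3))) (C (9 / 2) 1))
  (cvgM (cvg_cst r^-1) (cvgB (cvgD (C (- (5 / 2)) r) (C 4 (2 * r)))
     (C (3 / 2) (3 * r))))).
Qed.

(** The derivative equals 1 on [1, r], and its value 5/2 at the knot 2/3 is chosen so that it
    integrates to 1 over [1/3, 1]. *)
Lemma trunc_id_id {R : realType} (r s : R) : 1 <= s -> s <= r ->
  trunc_id r s = s.
Proof.
move=> s1 sr; rewrite /trunc_id /sqpos.
rewrite !(max_l (_ : s - r <= 0)) ?(max_l (_ : s - 2 * r <= 0))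
  ?(max_l (_ : s - 3 * r <= 0)) ?(max_r (_ : 0 <= s - 1))
  ?(max_r (_ : 0 <= s - _ / _)); try lra.
Qed.

Lemma trunc_id_small {R : realType} (r s : R) : 1 <= r -> s <= 1 / 3 ->
  trunc_id r s = 0.
Proof.
move=> r1 s1; rewrite /trunc_id /sqpos !max_l; try lra.
Qed.

(** The value -3/2 at the knot 2 r makes the derivative integrate to -r over [r, 3 r], which cancels
    the value r reached at r. *)
Lemma trunc_id_large {R : realType} (r s : R) : 1 <= r -> 3 * r <= s ->
  trunc_id r s = 0.
Proof.
move=> r1 s1; rewrite /trunc_id /sqpos !max_r; try lra.
by field; apply/eqP; lra.
Qed.

(** To the right of 1 the derivative interpolates the knot values 1, 1, -3/2, 0, whatever [r] is;
    the steeper value 5/2 sits at 2/3. *)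
Lemma norm_trunc_id'_le {R : realType} (r s : R) : 1 <= r -> 1 <= s ->
  `|trunc_id' r s| <= 3 / 2.
Proof.
move=> r1 s1; have r0 : 0 < r by lra.
(* Multiplying by [r] removes [r^-1], so that the case analysis at the three upper knots is
   linear. *)
rewrite -(ler_pM2l r0) -{1}(gtr0_norm r0) -normrM.
have -> : r * trunc_id' r s = r + (- (5 / 2) * Num.max 0 (s - r)
    + 4 * Num.max 0 (s - 2 * r) - 3 / 2 * Num.max 0 (s - 3 * r)).
  rewrite /trunc_id' (@max_r _ _ _ (s - 1 / 3)) ?(@max_r _ _ _ (s - 2 / 3))
    ?(@max_r _ _ _ (s - 1)); try lra.
  by field; rewrite gt_eqF.
rewrite ler_norml.
have [H|H] := lerP 0 (s - r); have [H'|H'] := lerP 0 (s - 2 * r);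
 have [H''|H''] := lerP 0 (s - 3 * r); apply/andP; split; lra.
Qed.

Lemma trunc_id_lipschitz {R : realType} (r s t : R) : 1 <= r -> 1 <= s -> s <= t ->
  `|trunc_id r t - trunc_id r s| <= 3 / 2 * (t - s).
Proof.
move=> r1 s1 st.
have [c /andP[]||c + ->] := @MVT_segment R (trunc_id r) (trunc_id' r) s t st.
- by move=> _ _; exact: is_derive_trunc_id.
- apply: continuous_subspaceT => x; apply/differentiable_continuous.
  by apply/derivable1_diffP; have [] := is_derive_trunc_id r x.
rewrite in_itv /= => /andP[sc _].
rewrite normrM (ger0_norm (_ : 0 <= t - s)) ?subr_ge0//.
by rewrite ler_wpM2r ?subr_ge0// norm_trunc_id'_le// (le_trans s1).
Qed.

(** The Lipschitz bound is used twice: from s to s + t, and from 1 to t, where the value 1 at 1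
    gives |g(t)| <= 1 + 3/2 (t - 1) <= 3/2 t. *)
Lemma trunc_id_increment {R : realType} (r s t : R) : 1 <= r -> 1 <= s -> 1 <= t ->
  `|trunc_id r (s + t) - trunc_id r s - trunc_id r t| <= 3 * t.
Proof.
move=> r1 s1 t1.
have H1 : `|trunc_id r (s + t) - trunc_id r s| <= 3 / 2 * t.
  by have := @trunc_id_lipschitz _ r s (s + t); rewrite addrC addrK; apply => //; lra.
have H2 : `|trunc_id r t| <= 3 / 2 * t.
  have := @trunc_id_lipschitz _ r 1 t r1 (lexx _) t1.
  rewrite (@trunc_id_id _ r 1)// !ler_norml => /andP[A B].
  by apply/andP; split; lra.
by move: H1 H2; rewrite !ler_norml => /andP[? ?] /andP[? ?]; apply/andP; split; lra.
Qed.

(** * Bounds on the kernel and on the collision integrand *)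

Lemma kernel_ref_sym {R : realType} (gamma p s t : R) : 0 < s + t ->
  kernel_ref gamma p s t = kernel_ref gamma p t s.
Proof.
move=> st; rewrite /kernel_ref /Phi addrC; congr (_ * _); rewrite [LHS]mulrC.
congr (_ `^ _ * _ `^ _); field; lra.
Qed.

(** The reference kernel is (s + t)^(gamma + 2 p) s^(-p) t^(-p). Its first exponent is non-negative,
    so s + t <= 2 s yields the constant and the power s^(gamma + p). The remaining t^(1 - p) is at
    most t^(gamma + p) because t >= 1 and 1 <= gamma + 2 p. *)
Lemma kernel_ref_min_le {R : realType} (gamma p s t : R) : 1 <= gamma + 2 * p ->
  1 <= t -> t <= s ->
  kernel_ref gamma p s t * t <=
  2 `^ (gamma + 2 * p) * (s `^ (gamma + p) * t `^ (gamma + p)).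
Proof.
move=> gp t1 ts; have s0 : 0 < s by lra.
have t0 : 0 < t by lra. have st0 : 0 < s + t by lra.
have nz x : 0 < x -> x != 0 :> R by move=> ?; rewrite gt_eqF.
have PD x a b : 0 < x -> x `^ (a + b) = x `^ a * x `^ b :> R.
  by move=> x0; rewrite powRD// nz ?implybT.
have -> : kernel_ref gamma p s t = (s + t) `^ (gamma + 2 * p) * (s `^ (- p) * t `^ (- p)).
  rewrite /kernel_ref /Phi.
  have -> : 1 - s / (s + t) = t / (s + t) by field; exact: nz.
  rewrite !powRM ?invr_ge0 ?ltW//.
  rewrite -(powR_inv1 (ltW st0)) -!powRrM.
  have -> : -1 * - p = p by ring.
  have -> : gamma + 2 * p = gamma + p + p by ring.
  by rewrite !PD//; ring.
rewrite -mulrA.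
apply: (@le_trans _ _ ((2 * s) `^ (gamma + 2 * p) * (s `^ (- p) * t `^ (- p) * t))).
  rewrite ler_wpM2r ?mulr_ge0 ?powR_ge0 ?(ltW t0)//.
  by apply: ge0_ler_powR; rewrite ?nnegrE; lra.
rewrite powRM; try lra.
rewrite -mulrA ler_wpM2l ?powR_ge0//.
rewrite !mulrA -PD//.
have -> : gamma + 2 * p - p = gamma + p by ring.
rewrite -mulrA ler_wpM2l ?powR_ge0//.
rewrite -{2}(powRr1 (ltW t0)) -PD//.
by apply: ler_powR => //; lra.
Qed.

Definition tail_weight {R : realType} (a rho s : R) : R :=
  if rho < s then s `^ a else 0.

Lemma tail_weight_ge0 {R : realType} (a rho s : R) : 0 <= tail_weight a rho s.
Proof. by rewrite /tail_weight; case: ifP => // _; exact: powR_ge0. Qed.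

Lemma coagulation_bound {R : realType} (gamma p c rho s t k : R) :
  1 <= gamma + 2 * p -> 1 <= rho -> 1 <= s -> 1 <= t ->
  0 <= k <= c * kernel_ref gamma p s t ->
  `|k * (trunc_id (2 * rho) (s + t) - trunc_id (2 * rho) s
         - trunc_id (2 * rho) t)| <=
  c * 3 * 2 `^ (gamma + 2 * p) *
    (tail_weight (gamma + p) rho s * t `^ (gamma + p)
     + s `^ (gamma + p) * tail_weight (gamma + p) rho t).
Proof.
move=> gp rho1.
(* Both sides are symmetric in [s] and [t], so [t] may be taken to be the smaller one. *)
wlog ts : s t / t <= s => [hw s1 t1|s1 t1].
  have [/hw|/ltW /hw {}hw kst] := lerP t s; first exact.
  have := hw t1 s1; rewrite -kernel_ref_sym; last by lra.
  move=> /(_ kst); congr (`|_ * _| <= _ * _); last by ring.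
  by rewrite [t + s]addrC; ring.
move=> /andP[k0 kc].
have K0 : 0 < kernel_ref gamma p s t.
  rewrite /kernel_ref /Phi !mulr_gt0 ?powR_gt0 ?divr_gt0//; try lra.
  by rewrite subr_gt0 ltr_pdivrMr; lra.
(* The sign of [c] is read off from the two bounds on [k], the reference kernel being positive. *)
have c0 : 0 <= c by rewrite -(pmulr_lge0 _ K0) (le_trans k0).
have [small|large] := lerP (s + t) (2 * rho).
  rewrite !trunc_id_id; try lra.
  have -> : s + t - s - t = 0 by ring.
  rewrite mulr0 normr0.
  by rewrite !(mulr_ge0, addr_ge0, powR_ge0, tail_weight_ge0).
(* The larger of two numbers is at least half their sum: this is why truncation at [2 * rho] goes
   with the tail beyond [rho]. *)
have srho : rho < s by lra.
rewrite normrM (ger0_norm k0).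
apply: (@le_trans _ _ (c * kernel_ref gamma p s t * (3 * t))).
  by apply: ler_pM => //; apply: trunc_id_increment => //; lra.
have -> : c * kernel_ref gamma p s t * (3 * t) =
    c * 3 * (kernel_ref gamma p s t * t) by ring.
rewrite -[leRHS]mulrA ler_wpM2l ?mulr_ge0//.
apply: le_trans (kernel_ref_min_le _ _ _ _ _ _ _) _ => //.
rewrite ler_wpM2l ?powR_ge0// /tail_weight srho lerDl.
by rewrite mulr_ge0 ?powR_ge0//; case: ifP => // _; exact: powR_ge0.
Qed.

(** * The l1-norm on the orthant and the test functions built on it *)

Lemma continuous_l1 {R : realType} (d : nat) : continuous (@l1 R d).
Proof.
apply: continuous_big => [x|j _]; first exact: add_continuous.
exact: coord_continuous.
Qed.

Lemma l1_is_linear {R : realType} (d : nat) : linear (@l1 R d).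
Proof.
move=> k x y; rewrite /l1 scaler_sumr -big_split /=.
by apply: eq_bigr => j _; rewrite !mxE.
Qed.

Lemma l1D {R : realType} (d : nat) (x y : 'rV[R]_d) : l1 (x + y) = l1 x + l1 y.
Proof. by rewrite -[x]scale1r l1_is_linear !scale1r. Qed.

Lemma is_diff_l1 {R : realType} (d : nat) (x : 'rV[R]_d) :
  is_diff x (@l1 R d) (@l1 R d).
Proof.
pose M := GRing.isLinear.Build _ _ _ _ (@l1 R d) (@l1_is_linear R d).
pose f : {linear 'rV[R]_d -> R} := HB.pack (@l1 R d) M.
apply: DiffDef; first exact: (@linear_differentiable _ _ _ f _ (@continuous_l1 R d)).
exact: (@diff_lin _ _ _ f _ (@continuous_l1 R d)).
Qed.

Lemma l1_ge0 {R : realType} (d : nat) (x : 'rV[R]_d) :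
  (forall j, 0 <= x ord0 j) -> 0 <= l1 x.
Proof. by move=> x0; apply: sumr_ge0. Qed.

(* The condition [x != 0] in [Rstar] compares the coefficient functions, not the
   matrices. *)
Lemma RstarP {R : realType} (d : nat) (x : 'rV[R]_d) :
  Rstar x <-> (forall j, 0 <= x ord0 j) /\ 0 < l1 x.
Proof.
split=> -[x0 nz]; split => //.
  rewrite lt_neqAle l1_ge0// andbT eq_sym; apply: contra nz => /eqP l0.
  apply/eqP/funext => i; apply/funext => j; rewrite ord1.
  have /eqP := l0; rewrite psumr_eq0// => /allP /(_ j (mem_index_enum _)).
  by move=> /= /eqP.
apply: contraTneq nz => xE; rewrite /l1 big1 ?ltxx// => j _.
by rewrite xE.
Qed.

Lemma closed_orthant {R : realType} (d : nat) :
  closed [set x : 'rV[R]_d | forall j, 0 <= x ord0 j].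
Proof.
rewrite (_ : mkset _ = \bigcap_(j in [set: 'I_d])
    ((fun x : 'rV[R]_d => x ord0 j) @^-1` [set t | 0 <= t])).
  apply: closed_bigI => j _; apply: closed_comp; last exact: closed_ge.
  by move=> x _; exact: coord_continuous.
by apply/seteqP; split=> x /= => [H j _|H j]; apply: H.
Qed.

(** The shell is closed and lies in the cube [0, b]^d, since each coordinate is at most the sum of
    all. *)
Lemma compact_l1_shell {R : realType} (d : nat) (a b : R) :
  compact [set x : 'rV[R]_d | (forall j, 0 <= x ord0 j) /\ a <= l1 x <= b].
Proof.
apply: (@subclosed_compact _ _
    [set x : 'rV[R]_d | forall j, `[0, b]%classic (x ord0 j)]).
- have -> : [set x : 'rV[R]_d | (forall j, 0 <= x ord0 j) /\ a <= l1 x <= b] =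
      [set x : 'rV[R]_d | forall j, 0 <= x ord0 j] `&`
      (@l1 R d @^-1` [set t | a <= t] `&` @l1 R d @^-1` [set t | t <= b]).
    by apply/seteqP; split=> x /= => [[? /andP[]]|[? []]]; split => //; apply/andP.
  apply: closedI; first exact: closed_orthant.
  have cl1 := continuous_l1 d.
  by apply: closedI; apply: closed_comp; [move=> x _; exact: cl1|exact: closed_ge|
    move=> x _; exact: cl1|exact: closed_le].
- by apply: (@rV_compact _ _ (fun=> `[0, b]%classic)) => _; exact: segment_compact.
- move=> x /= [x0 /andP[_ xb]] j; rewrite in_itv /= x0 /=.
  apply: le_trans xb; rewrite /l1 (bigD1 j)//= lerDl.
  exact: sumr_ge0.
Qed.

Lemma C1c_trunc_id {R : realType} (d : nat) (r : R) : 1 <= r ->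
  C1c (fun x : 'rV[R]_d => trunc_id r (l1 x)).
Proof.
move=> r1; split.
  have dg s : is_diff s (trunc_id r) (fun h => h *: trunc_id' r s).
    have Dg := is_derive_trunc_id r s.
    have dif : differentiable (trunc_id r) s by apply/derivable1_diffP.
    by apply: DiffDef => //; rewrite diff1E// derive1E derive_val.
  have dphi (x : 'rV[R]_d) : is_diff x (trunc_id r \o @l1 R d)
      ((fun h => h *: trunc_id' r (l1 x)) \o @l1 R d).
    exact: is_diff_comp (is_diff_l1 d x) (dg (l1 x)).
  exists setT; split; [exact: openT|by []|by move=> x _; have [] := dphi x|].
  move=> v x _.
  have -> : 'D_v (fun x : 'rV[R]_d => trunc_id r (l1 x)) =
      fun x => l1 v * trunc_id' r (l1 x).
    apply/funext => y; have [dy E] := dphi y.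
    by rewrite deriveE// E.
  apply: (@continuousM _ _ (cst (l1 v)) (fun y => trunc_id' r (l1 y)) x);
    first exact: cst_continuous.
  exact: (continuous_comp (continuous_l1 d x) (continuous_trunc_id' r (l1 x))).
(* The compact shell between the outermost knots 1/3 and 3 r is closed, so it also contains the
   closure. *)
have sub : closure (Rstar (d := d) `&` [set x | trunc_id r (l1 x) != 0]) `<=`
    [set x : 'rV[R]_d | (forall j, 0 <= x ord0 j) /\ 1 / 3 <= l1 x <= 3 * r].
  have cS := compact_closed (@norm_hausdorff _ _) (@compact_l1_shell R d (1 / 3) (3 * r)).
  rewrite [X in _ `<=` X](closure_id _).1//; apply: closure_subset.
  move=> x [[x0 _] /= nz]; split => //.
  apply/andP; split; rewrite leNgt; apply: contra nz => H.
    by rewrite trunc_id_small// ltW.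
  by rewrite trunc_id_large// ltW.
(* Since 1/3 > 0 the shell avoids the origin, so the closure taken in R^d already lies in R^d_*. *)
rewrite (setIidr _); last first.
  by move=> x /sub [x0 /andP[x1 _]]; apply/RstarP; split => //; lra.
exact: (subclosed_compact (@closed_closure _ _)
  (@compact_l1_shell R d (1 / 3) (3 * r)) sub).
Qed.

(** * Borel sets of R^d and null sets outside the support *)

Section borel.
Context {R : realType} {d : nat}.
Implicit Types (A : set 'rV[R]_d) (mu : {measure set (borelRd R d) -> \bar R}).

Lemma borelRd_open A : open A -> measurable (A : set (borelRd R d)).
Proof. exact: sub_sigma_algebra. Qed.

Lemma borelRd_closed A : closed A -> measurable (A : set (borelRd R d)).
Proof.
by move=> cA; rewrite -(setCK A); apply: measurableC;
  apply: borelRd_open; exact: closed_openC.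
Qed.

Lemma continuous_borelRd (f : 'rV[R]_d -> R) : continuous f ->
  measurable_fun setT (f : borelRd R d -> R).
Proof.
move=> cf; apply: (measurability _ (RGenOpens.measurableE R)).
move=> _ [_ [a [b ->] <-]]; rewrite setTI.
by apply: borelRd_open; apply: open_comp; [move=> x _; exact: cf|exact: interval_open].
Qed.

Lemma measurable_l1 : measurable_fun setT (@l1 R d : borelRd R d -> R).
Proof. apply: continuous_borelRd; exact: continuous_l1. Qed.

Lemma measurable_Rstar : measurable (@Rstar R d : set (borelRd R d)).
Proof.
rewrite (_ : @Rstar R d = [set x : 'rV[R]_d | forall j, 0 <= x ord0 j] `&`
    @l1 R d @^-1` [set t | 0 < t]); last by apply/seteqP; split=> x /RstarP.
apply: measurableI; first by apply: borelRd_closed; exact: closed_orthant.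
apply: borelRd_open; apply: open_comp; last exact: open_gt.
by move=> x _; exact: continuous_l1.
Qed.

Lemma measurable_Rstar_l1 (I : set R) : measurable I ->
  measurable (Rstar (d := d) `&` (@l1 R d) @^-1` I : set (borelRd R d)).
Proof.
move=> mI; apply: measurableI; first exact: measurable_Rstar.
by rewrite -[X in measurable X]setTI; apply: measurable_l1.
Qed.

(* Inner regularity replaces second countability: a compact set
   of points outside the support is covered by finitely many null open sets. *)
Lemma radon_outside_support0 mu A :
  radon_on_Rstar mu -> measurable (A : set (borelRd R d)) ->
  A `<=` Rstar (d := d) `\` msupport mu -> mu A = 0%E.
Proof.
move=> [_ _ inner] mA AS.
rewrite inner//; last by move=> x /AS [].
apply/eqP; rewrite eq_le; apply/andP; split; last first.
  apply: ereal_sup_ubound; exists set0; last exact: measure0.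
  by split; [exact: compact0|].
apply: ge_ereal_sup => _ [C [cC CA] <-].
pose D := [set U : set 'rV[R]_d | open U /\ mu U = 0%E].
have : cover_compact C by rewrite -compact_cover.
move=> /(_ _ D id)[|x Cx|E ED CE].
- by move=> U [].
- have [Rx nsx] := AS _ (CA _ Cx).
  have : ~ forall U : set 'rV[R]_d, open U -> U x -> (0 < mu U)%E.
    by move=> H; apply: nsx; split.
  move=> /existsNP[U /not_implyP[oU /not_implyP[Ux]]].
  move=> /negP; rewrite -leNgt => U0; exists U => //; split => //.
  by apply/eqP; rewrite eq_le U0 measure_ge0.
have mC : measurable (C : set (borelRd R d)).
  by apply: borelRd_closed; apply: compact_closed.
have mE (U : set 'rV[R]_d) : U \in E -> measurable (U : set (borelRd R d)).
  by move=> /ED /set_mem[oU _]; exact: borelRd_open.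
have := @content_sub_fsum _ _ _ mu _ _ C id (finite_fset E) mE mC CE.
by rewrite fsbig1// => U /= /ED /set_mem[].
Qed.

End borel.

(** * Domination of signed integrals and sums, and smallness of tails *)

(* [S] stands for the signed integral, resp. the signed sum, against the
   solution, and [M], [E] for the values of [S] at [w], [v]. The integrands are
   arbitrary functions: the inner integral of the collision term is not known to
   be measurable in the outer variable. *)
Definition dominated {R : realType} {T : Type} (S : (T -> \bar R) -> \bar R)
    (D : set T) (w v : T -> R) (M E : R) : Prop :=
  forall (f : T -> \bar R) (k l : R), 0 <= k -> 0 <= l ->
    (forall x, D x -> `|f x| <= (k * w x + l * v x)%:E)%E ->
    (`|S f| <= (k * M + l * E)%:E)%E.

(** The inner application gives [C * M * v y + C * E * w y], again a combination of [w] and [v], so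
    the outer one applies; its two equal cross terms account for the factor 2. *)
Lemma dominated_iter {R : realType} {T : Type} (S : (T -> \bar R) -> \bar R)
    (D : set T) (w v : T -> R) (M E C : R) (G : T -> T -> \bar R) :
  dominated S D w v M E -> 0 <= M -> 0 <= E -> 0 <= C ->
  (forall x, D x -> 0 <= w x) -> (forall x, D x -> 0 <= v x) ->
  (forall x y, D x -> D y -> `|G x y| <= (C * (v x * w y + w x * v y))%:E)%E ->
  (`|S (fun y => S (fun x => G x y))| <= (C * 2 * M * E)%:E)%E.
Proof.
move=> dom M0 E0 C0 w0 v0 GC.
have -> : C * 2 * M * E = (C * E) * M + (C * M) * E by ring.
apply: (dom); rewrite ?mulr_ge0// => y Dy.
have -> : C * E * w y + C * M * v y = (C * v y) * M + (C * w y) * E by ring.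
apply: dom; rewrite ?mulr_ge0 ?w0 ?v0// => x Dx.
have -> : C * v y * w x + C * w y * v x = C * (v x * w y + w x * v y) by ring.
exact: GC.
Qed.

Lemma abse_sub_le {R : realType} (a b : \bar R) (c : R) :
  (0 <= a -> 0 <= b -> a <= c%:E -> b <= c%:E -> `|a - b| <= c%:E)%E.
Proof.
case: a b => [a||] [b||]//; rewrite !lee_fin => a0 b0 ac bc.
by rewrite /= ?lee_fin ler_norml; apply/andP; split; lra.
Qed.

Lemma funepos_le_abs {R : realType} {T : Type} (f : T -> \bar R) x :
  (f^\+ x <= `|f x|)%E.
Proof. by rewrite funeposE ge_max lee_abs abse_ge0. Qed.

Lemma funeneg_le_abs {R : realType} {T : Type} (f : T -> \bar R) x :
  (f^\- x <= `|f x|)%E.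
Proof. by rewrite funenegE ge_max abse_ge0 -abseN lee_abs. Qed.

(** The integral of a non-negative function is a supremum over the simple functions below it, and
    this family grows with the function, measurable or not. *)
Lemma ge0_le_integral_left {d} {T : measurableType d} {R : realType}
    (mu : {measure set T -> \bar R}) (D : set T) (f g : T -> \bar R) :
  (forall x, D x -> 0 <= f x)%E -> (forall x, D x -> f x <= g x)%E ->
  (\int[mu]_(x in D) f x <= \int[mu]_(x in D) g x)%E.
Proof.
move=> f0 fg; rewrite !ge0_integralE//; last first.
  by move=> x Dx; exact: le_trans (f0 x Dx) (fg x Dx).
apply: ereal_sup_le => _ [h hf <-]; exists h => //= x.
apply: le_trans (hf x) _; rewrite !patchE.
by case: ifPn => // /set_mem /fg.
Qed.

(** [N] is a null set off which the pointwise bound on the integrand holds. *)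
Lemma integral_dominated {d} {T : measurableType d} {R : realType}
    (mu : {measure set T -> \bar R}) (D N : set T) (w v : T -> R) (M E : R) :
  measurable D -> measurable N -> mu N = 0%E ->
  measurable_fun D w -> measurable_fun D v ->
  (forall x, D x -> 0 <= w x) -> (forall x, D x -> 0 <= v x) ->
  (\int[mu]_(x in D) (w x)%:E = M%:E)%E ->
  (\int[mu]_(x in D) (v x)%:E = E%:E)%E ->
  dominated (fun f => \int[mu]_(x in D) f x)%E (D `\` N) w v M E.
Proof.
move=> mD mN N0 mw mv w0 v0 wM vE f k l k0 l0 fb.
pose h (x : T) : \bar R := (k * w x + l * v x)%:E.
have h0 x : D x -> (0 <= h x)%E.
  by move=> Dx; rewrite lee_fin addr_ge0 ?mulr_ge0 ?w0 ?v0.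
have mh : measurable_fun D h.
  apply/measurable_EFinP; apply: measurable_funD;
    by apply: measurable_funM => //; exact: measurable_cst.
have intZ (u : T -> R) c : measurable_fun D u -> (forall x, D x -> 0 <= u x) ->
    0 <= c -> (\int[mu]_(x in D) (c * u x)%:E = c%:E * \int[mu]_(x in D) (u x)%:E)%E.
  move=> mu' u0 c0; under eq_integral do rewrite EFinM.
  by apply: ge0_integralZl => //; exact/measurable_EFinP.
have mZ (u : T -> R) c : measurable_fun D u -> measurable_fun D (fun x => (c * u x)%:E).
  move=> mu'; apply/measurable_EFinP; exact: measurable_funM.
have inth : (\int[mu]_(x in D) h x = (k * M + l * E)%:E)%E.
  rewrite /h; under eq_integral do rewrite EFinD.
  rewrite ge0_integralD//; [|by move=> x Dx; rewrite lee_fin mulr_ge0 ?w0|exact: mZ|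
    by move=> x Dx; rewrite lee_fin mulr_ge0 ?v0|exact: mZ].
  by rewrite !intZ// wM vE.
have main (g : T -> \bar R) : (forall x, D x -> 0 <= g x)%E ->
    (forall x, (g x <= `|f x|)%E) ->
    (\int[mu]_(x in D) g x <= (k * M + l * E)%:E)%E.
  move=> g0 gf; rewrite -inth.
  (* As [f] may fail to be measurable, it is not modified on [N]; instead the dominating function is
     raised to +oo there, which keeps its integral and makes the bound hold on all of [D]. *)
  pose h' (x : T) : \bar R := if x \in N then +oo%E else h x.
  have mh' : measurable_fun D h'.
    apply: measurable_fun_if => //.
    - apply: (measurable_fun_bool true).
      rewrite [X in measurable X](_ : _ = D `&` N); first exact: measurableI.
      by apply/seteqP; split=> x /= [Dx Nx]; split; rewrite ?mem_set//; exact: set_mem.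
    - exact: measurable_funS mh.
  have -> : (\int[mu]_(x in D) h x = \int[mu]_(x in D) h' x)%E.
    apply: ge0_ae_eq_integral => //.
      by move=> x Dx; rewrite /h'; case: ifP => // _; exact: h0.
    exists N; split => // x /= /not_implyP[Dx]; apply: contra_notP => Nx.
    by rewrite /h' memNset.
  apply: ge0_le_integral_left => // x Dx.
  rewrite /h'; case: ifPn => [_|/negP xN]; first exact: leey.
  apply: le_trans (gf x) (fb x _); split => //.
  by move=> Nx; apply: xN; exact: mem_set.
rewrite integralE; apply: abse_sub_le.
- by apply: integral_ge0 => x _; exact: funepos_ge0.
- by apply: integral_ge0 => x _; exact: funeneg_ge0.
- by apply: main => x; [move=> _; exact: funepos_ge0|exact: funepos_le_abs].
- by apply: main => x; [move=> _; exact: funeneg_ge0|exact: funeneg_le_abs].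
Qed.

(** Dominated convergence along integer cut-offs: at each point the truncated integrand is 0 once
    the cut-off reaches [m x]. *)
Lemma integral_tail_small {d} {T : measurableType d} {R : realType}
    (mu : {measure set T -> \bar R}) (D : set T) (m w : T -> R) (e a : R) :
  measurable D -> measurable_fun setT m -> measurable_fun D w ->
  (forall x, D x -> 0 <= w x) ->
  (\int[mu]_(x in D) (w x)%:E < +oo)%E -> 0 < e ->
  exists2 rho, a <= rho &
    (\int[mu]_(x in D) (if rho < m x then w x else 0)%:E <= e%:E)%E.
Proof.
move=> mD mm mw w0 wfin e0.
pose v (n : nat) (x : T) : \bar R := (if n%:R < m x then w x else 0)%:E.
have mv n : measurable_fun D (v n).
  apply/measurable_EFinP; apply: measurable_fun_if => //.
  + by apply: measurable_fun_ltr; [exact: measurable_cst|exact: measurable_funTS].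
  + exact: measurable_funS mw.
have vw n x : D x -> (`|v n x| <= (w x)%:E)%E.
  by move=> Dx; rewrite lee_fin; case: ifP => _; rewrite ?normr0 ?ger0_norm ?w0.
have iw : mu.-integrable D (EFin \o w).
  apply/integrableP; split; first exact/measurable_EFinP.
  by under eq_integral => x /set_mem Dx do rewrite /= ger0_norm ?w0//.
have v0 : {ae mu, forall x, D x -> v ^~ x @ \oo --> (0 : \bar R)}.
  apply: aeW => x _; apply: cvg_near_cst; near=> n.
  rewrite /v ifN// -leNgt; near: n; exact: nbhs_infty_ger.
have v_le : {ae mu, forall x n, D x -> (`|v n x| <= (EFin \o w) x)%E}.
  by apply: aeW => x n; exact: vw.
have := dominated_convergence mD mv (measurable_cst 0%E) v0 iw v_le.
rewrite integral0 => -[_ _ cv].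
have /cv [n0 _ Hn] : nbhs 0%E [set y : \bar R | (y <= e%:E)%E].
  exists e => //= y; rewrite /ball /= sub0r normrN => ye.
  by rewrite lee_fin (le_trans (ler_norm y))// ltW.
have [n /andP[n0n an]] : exists n : nat, (n0 <= n)%N && (a <= n%:R).
  exists (maxn n0 (Num.bound `|a|)); rewrite leq_maxl /=.
  apply: le_trans (ler_norm a) _; apply: le_trans (ltW (archi_boundP (normr_ge0 a))) _.
  by rewrite ler_nat leq_maxr.
by exists n%:R => //; exact: Hn.
Unshelve. all: by end_near. Qed.

(** Each [esum] is a supremum over finite subsets, so bounding finite sums of the positive and
    negative parts suffices. *)
Lemma signed_esum_dominated {R : realType} {T : choiceType} (D : set T)
    (w v : T -> R) (M E : R) :
  (forall x, D x -> 0 <= w x) -> (forall x, D x -> 0 <= v x) ->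
  (\esum_(x in D) (w x)%:E = M%:E)%E -> (\esum_(x in D) (v x)%:E = E%:E)%E ->
  dominated (signed_esum D) D w v M E.
Proof.
move=> w0 v0 wM vE f k l k0 l0 fb.
have main (g : T -> \bar R) : (forall x, (g x <= `|f x|)%E) ->
    (\esum_(x in D) g x <= (k * M + l * E)%:E)%E.
  move=> gf; apply: ge_ereal_sup => _ [X [finX XD] <-].
  apply: (@le_trans _ _ (\sum_(x \in X) (k * w x + l * v x)%:E)%E).
    by apply: lee_fsum => // x /XD Dx; exact: le_trans (gf x) (fb x Dx).
  rewrite fsumEFin// lee_fin.
  rewrite fsbig_split//= -!mulr_fsumr// lerD// ler_wpM2l// -lee_fin -fsumEFin//.
    by rewrite -wM; apply: esum_ge; exists X.
  by rewrite -vE; apply: esum_ge; exists X.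
apply: abse_sub_le.
- by apply: esum_ge0 => x _; exact: funepos_ge0.
- by apply: esum_ge0 => x _; exact: funeneg_ge0.
- by apply: main => x; exact: funepos_le_abs.
- by apply: main => x; exact: funeneg_le_abs.
Qed.

(** A finite set [X] carries all of the sum up to [e]; with [rho] at least the maximum of [m] over
    [X], the tail lives off [X]. *)
Lemma esum_tail_small {R : realType} {T : choiceType} (D : set T)
    (m w : T -> R) (e a : R) :
  (forall x, D x -> 0 <= w x) -> (\esum_(x in D) (w x)%:E < +oo)%E -> 0 < e ->
  exists2 rho, a <= rho &
    (\esum_(x in D) (if rho < m x then w x else 0)%:E <= e%:E)%E.
Proof.
move=> w0 wfin e0.
have S0 : (0 <= \esum_(x in D) (w x)%:E)%E by apply: esum_ge0 => x /w0; rewrite lee_fin.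
have wf : (\esum_(x in D) (w x)%:E)%E \is a fin_num by rewrite ge0_fin_numE.
have [_ [X [finX XD] <-] hX] := ub_ereal_sup_adherent e0 wf.
pose rho := \big[Num.max/a]_(i <- fset_set X) m i.
exists rho; first exact: bigmax_ge_id.
have mrho x : X x -> m x <= rho.
  by move=> Xx; apply: le_bigmax_seq => //; rewrite in_fset_set// mem_set.
pose v x := if rho < m x then w x else 0.
pose u x := if x \in X then w x else 0.
have split_le : (\esum_(x in D) (v x)%:E + \esum_(x in D) (u x)%:E <=
    \esum_(x in D) (w x)%:E)%E.
  rewrite -esumD; last 2 first.
  - by move=> x Dx; rewrite lee_fin /v; case: ifP => // _; exact: w0.
  - by move=> x Dx; rewrite lee_fin /u; case: ifP => // _; exact: w0.
  apply: le_esum => x Dx; rewrite -EFinD lee_fin /v /u.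
  case: ifPn => [rm|_]; last by rewrite add0r; case: ifP => // _; exact: w0.
  rewrite memNset ?addr0// => /mrho.
  by rewrite leNgt rm.
have uX : (\sum_(x \in X) (w x)%:E <= \esum_(x in D) (u x)%:E)%E.
  apply: esum_ge; exists X => //.
  by apply: lee_fsum => // x Xx; rewrite /u mem_set.
have V0 : (0 <= \esum_(x in D) (v x)%:E)%E.
  by apply: esum_ge0 => x Dx; rewrite lee_fin /v; case: ifP => // _; exact: w0.
have := le_trans (leeD2l _ uX) split_le.
move: hX V0; rewrite -/(esum D (fun x => (w x)%:E)) -(fineK wf) fsumEFin//.
case: (\esum_(x in D) (v x)%:E)%E => [V||]//.
by rewrite -EFinB -EFinD !lee_fin lte_fin; lra.
Qed.

(** * The weak equation and lower bounds on its source term *)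

(** The bound on [X] makes it finite, so the equation makes [Y] finite too, and y <= Y = - X / 2 <=
    e / 2 contradicts e < y. *)
Lemma weak_equation_absurd {R : realType} (X Y : \bar R) (e y : R) :
  (0 = 2^-1%:E * X + Y)%E -> (`|X| <= e%:E)%E -> (y%:E <= Y)%E -> e < y -> False.
Proof.
case: X Y => [X||] [Y||]//.
rewrite -EFinM -EFinD => -[XY] /=; rewrite !lee_fin ler_norml => /andP[? ?] ? ?.
lra.
Qed.

Lemma continuous_trunc_id {R : realType} (r : R) : continuous (trunc_id r).
Proof.
move=> x; apply/differentiable_continuous/derivable1_diffP.
by have [] := is_derive_trunc_id r x.
Qed.

Lemma toRD {R : realType} (d : nat) (a b : 'rV[nat]_d) :
  toR R (a + b) = toR R a + toR R b.
Proof. by apply/rowP => j; rewrite !mxE natrD. Qed.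

(** Some entry is at least 1. This is the discrete counterpart of the support condition |x| >= 1. *)
Lemma l1_toR_ge1 {R : realType} (d : nat) (a : 'rV[nat]_d) :
  Nstar a -> 1 <= l1 (toR R a).
Proof.
move=> a0; have [j aj] : exists j, (0 < a ord0 j)%N.
  apply/existsP; apply: contraNT a0 => /existsPn H.
  by apply/eqP/rowP => j; apply/eqP; rewrite mxE -leqn0 leqNgt H.
rewrite /l1 (bigD1 j)//= mxE -[leLHS]addr0 lerD ?ler1n//.
by apply: sumr_ge0 => i _; rewrite mxE.
Qed.

Lemma weak_source_ge {R : realType} {d : nat}
    (eta : {measure set (borelRd R d) -> \bar R}) (L r : R) :
  radon_on_Rstar eta -> msupport eta `<=` [set x | 1 <= l1 x <= L] -> L <= r ->
  (eta (@Rstar R d) <= \int[eta]_(x in @Rstar R d) (trunc_id r (l1 x))%:E)%E.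
Proof.
move=> etaR supp Lr.
have mD := @measurable_Rstar R d.
have mphi : measurable_fun setT (fun x : borelRd R d => trunc_id r (l1 x)).
  apply: (@continuous_borelRd R d (fun x => trunc_id r (l1 x))) => x.
  exact: (continuous_comp (continuous_l1 d x) (continuous_trunc_id r (l1 x))).
have mphi' : measurable_fun setT (fun x : borelRd R d => Num.max 1 (trunc_id r (l1 x))).
  by apply: measurable_maxr => //; exact: measurable_cst.
pose N : set (borelRd R d) := @Rstar R d `&` @l1 R d @^-1` (~` `[1, L]).
have mN : measurable N.
  by apply: measurable_Rstar_l1; apply: measurableC; exact: measurable_itv.
have N0 : eta N = 0%E.
  apply: radon_outside_support0 => // x [Rx /= nx]; split => //.
  by move=> /supp /= H; apply: nx; rewrite /= in_itv.
(* Off the null set [N] the test function equals |x| >= 1, so taking its maximum with 1 keeps the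
   integral and allows comparison with the constant 1 on all of R^d_*. *)
rewrite (@ae_eq_integral _ _ _ eta _
  (fun x => (Num.max 1 (trunc_id r (l1 x)))%:E))//; last 3 first.
- exact/measurable_EFinP/measurable_funTS.
- exact/measurable_EFinP/measurable_funTS.
- exists N; split => // x /= /not_implyP[Dx ne]; split => // /=.
  rewrite in_itv /= => /andP[x1 xL]; apply: ne.
  by rewrite trunc_id_id ?(le_trans xL)// max_r.
rewrite -[leLHS]mul1e -integral_cst//.
apply: ge0_le_integral => //.
- exact/measurable_EFinP/measurable_funTS.
- by move=> x _; rewrite lee_fin le_max lexx.
Qed.

(** The complement of R^d_* is null, so if R^d_* were null too, every measurable set would be. *)
Lemma measure_Rstar_gt0 {R : realType} {d : nat}
    (eta : {measure set (borelRd R d) -> \bar R}) A :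
  radon_on_Rstar eta -> measurable A -> eta A != 0%E -> (0 < eta (@Rstar R d))%E.
Proof.
move=> [eta0 _ _] mA; apply: contraNT; rewrite -leNgt => D0.
have mD := @measurable_Rstar R d.
rewrite eq_le measure_ge0 andbT.
apply: (@le_trans _ _ (eta (@Rstar R d `|` ~` @Rstar R d))).
  apply: le_measure; [exact: mem_set| |by rewrite setUv].
  by apply: mem_set; apply: measurableU => //; exact: measurableC.
have mDc := measurableC mD.
have DDc := measureU0 mD mDc eta0.
by apply: le_trans D0; rewrite le_eqVlt; apply/orP; left; exact/eqP.
Qed.

(** Dividing by [c + 1] rather than [c] covers [c = 0] and makes the inequality strict. *)
Lemma scaled_lt {R : realType} (c E y : R) : 0 <= c -> 0 < y -> E <= y / (c + 1) ->
  c * E < y.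
Proof.
move=> c0 y0; rewrite ler_pdivlMr; last by lra.
rewrite mulrDr mulr1 mulrC; have [E0|E0] := ltrP 0 E; first lra.
by have := mulr_ge0_le0 c0 E0; lra.
Qed.

(** * Non-existence for measures *)

Lemma no_stationary_injection_solution {R : realType} {d : nat} (gamma p c L : R)
    (K : 'rV[R]_d -> 'rV[R]_d -> R)
    (eta f : {measure set (borelRd R d) -> \bar R}) :
  1 <= gamma + 2 * p -> 0 <= c ->
  (forall x y, Rstar x -> Rstar y ->
     0 <= K x y <= c * kernel_ref gamma p (l1 x) (l1 y)) ->
  bounded_radon_on_Rstar eta -> (exists2 A, measurable A & eta A != 0%E) ->
  msupport eta `<=` [set x | 1 <= l1 x <= L] ->
  ~ stationary_injection_solution K gamma p eta f.
Proof.
move=> gp c0 Kb [etaR etab] [A mA A0] supp [fR fsupp fint feq].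
have mD := @measurable_Rstar R d.
have y0 := measure_Rstar_gt0 eta A etaR mA A0.
have yfin : eta (@Rstar R d) \is a fin_num.
  rewrite ge0_fin_numE//; apply: le_lt_trans etab.
  by apply: le_measure => //; apply: mem_set.
move: y0; rewrite -(fineK yfin) lte_fin; set y := fine _ => y0.
pose D : set (borelRd R d) := @Rstar R d.
pose w (x : borelRd R d) : R := l1 x `^ (gamma + p).
have mw : measurable_fun (D) w.
  apply: measurable_funTS; apply: (@measurableT_comp _ _ _ _ _ _
    (fun t : R => t `^ (gamma + p))).
    exact: measurable_powR.
  exact: measurable_l1.
have w0 x : D x -> 0 <= w x by rewrite powR_ge0.
have M0 : (0 <= \int[f]_(x in D) (w x)%:E)%E.
  by apply: integral_ge0 => x Dx; rewrite lee_fin w0.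
have wM : (\int[f]_(x in D) (w x)%:E =
    (fine (\int[f]_(x in D) (w x)%:E))%:E)%E.
  by rewrite fineK// ge0_fin_numE.
move: wM; set M := fine _ => wM; rewrite wM lee_fin in M0.
pose C := c * 3 * 2 `^ (gamma + 2 * p).
have C0 : 0 <= C by rewrite !mulr_ge0 ?powR_ge0.
(* The collision term will be at most [C * 2 * M * E]; a tail [E] below this tolerance puts it under
   the source mass [y]. *)
have e0 : 0 < y / (C * 2 * M + 1) by rewrite divr_gt0// ltr_pwDr// !mulr_ge0.
(* The bound on the collision integrand asks for [1 <= rho], the source estimate for
   [L <= 2 * rho]. *)
have [rho rho1 vsmall] := @integral_tail_small _ _ _ f _ (@l1 R d) w _
  (Num.max 1 L) mD (@measurable_l1 R d) mw w0 fint e0.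
move: rho1; rewrite ge_max => /andP[rho1 rhoL].
pose v (x : borelRd R d) : R := tail_weight (gamma + p) rho (l1 x).
have v0 x : D x -> 0 <= v x by rewrite tail_weight_ge0.
have mv : measurable_fun (D) v.
  apply: measurable_fun_if => //.
  + apply: measurable_fun_ltr; first exact: measurable_cst.
    by apply: measurable_funTS; exact: measurable_l1.
  + exact: measurable_funS mw.
have E0 : (0 <= \int[f]_(x in D) (v x)%:E)%E.
  by apply: integral_ge0 => x Dx; rewrite lee_fin v0.
have vE : (\int[f]_(x in D) (v x)%:E =
    (fine (\int[f]_(x in D) (v x)%:E))%:E)%E.
  by rewrite fineK// ge0_fin_numE//; apply: le_lt_trans vsmall _; exact: ltry.
have {}vsmall : (\int[f]_(x in D) (v x)%:E <= (y / (C * 2 * M + 1))%:E)%E by [].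
move: vE; set E := fine _ => vE; rewrite vE !lee_fin in E0 vsmall.
(* The part of R^d_* with |x| < 1 is null for [f]; off it the bounds for s, t >= 1 are available. *)
pose N : set (borelRd R d) := D `&` @l1 R d @^-1` `]-oo, 1[.
have mN : measurable N by apply: measurable_Rstar_l1; exact: measurable_itv.
have N0 : f N = 0%E.
  apply: radon_outside_support0 => // x [Rx /= nx]; split => //.
  by move=> /fsupp /=; rewrite leNgt; move: nx; rewrite in_itv /= => ->.
have dom := integral_dominated f _ N w v M E mD mN N0 mw mv w0 v0 wM vE.
have DN x : (D `\` N) x -> 1 <= l1 x.
  by move=> [Dx nN]; rewrite leNgt; apply/negP => l1x; apply: nN; split.
have r1 : 1 <= 2 * rho by lra.
have Lr : L <= 2 * rho by lra.
apply: (@weak_equation_absurd R _ _ (C * 2 * M * E) y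
  (feq _ (C1c_trunc_id d (2 * rho) r1)) _ _ _).
- apply: (dominated_iter _ _ _ _ _ _ C
    (fun x y => (K x y * (trunc_id (2 * rho) (l1 (x + y)) - trunc_id (2 * rho) (l1 x)
       - trunc_id (2 * rho) (l1 y)))%:E) dom) => //.
  + by move=> x [Dx _]; exact: w0.
  + by move=> x [Dx _]; exact: v0.
  + move=> x z Dx Dz; rewrite lee_fin l1D.
    apply: coagulation_bound => //; try exact: DN.
    by apply: Kb; [case: Dx|case: Dz].
- by rewrite /y fineK//; exact: (weak_source_ge eta L _ etaR supp Lr).
- by apply: scaled_lt; rewrite ?mulr_ge0.
Qed.

(** * Non-existence for sequences *)

(** On the support of [s] the test function is at least 1, so all terms are non-negative, the
    negative part sums to 0, and the term at [a0] bounds the sum from below. *)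
Lemma discrete_source_ge {R : realType} {d : nat} (s : 'rV[nat]_d -> R) (L r : R) a0 :
  (forall a, Nstar a -> 0 <= s a) ->
  (forall a, Nstar a -> s a != 0 -> l1 (toR R a) <= L) -> L <= r ->
  Nstar a0 ->
  ((s a0)%:E <= signed_esum (@Nstar d) (fun a => (trunc_id r (l1 (toR R a)) * s a)%:E))%E.
Proof.
move=> s0 sL Lr Na0.
have term a : Nstar a -> s a <= trunc_id r (l1 (toR R a)) * s a.
  move=> Na; have [->|sa] := eqVneq (s a) 0; first by rewrite mulr0.
  rewrite trunc_id_id ?l1_toR_ge1 ?(le_trans (sL a Na sa))//.
  by rewrite ler_peMl ?s0 ?l1_toR_ge1.
rewrite /signed_esum [X in (_ - X)%E]esum1 ?sube0; last first.
  move=> a Na; rewrite funenegE; apply/max_idPr.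
  by rewrite leeNl oppe0 lee_fin (le_trans (s0 a Na)) ?term.
apply: esum_ge; exists [set a0].
  by split; [exact: finite_set1|move=> _ ->].
rewrite fsbig_set1 funeposE.
apply: le_trans (_ : _ <= (trunc_id r (l1 (toR R a0)) * s a0)%:E)%E _.
  by rewrite lee_fin term.
by rewrite le_max lexx.
Qed.

Lemma no_discrete_stationary_injection_solution {R : realType} {d : nat}
    (gamma p c : R) (K : 'rV[nat]_d -> 'rV[nat]_d -> R) (s n : 'rV[nat]_d -> R) :
  1 <= gamma + 2 * p -> 0 <= c ->
  (forall a b, Nstar a -> Nstar b ->
     0 <= K a b <= c * kernel_ref gamma p (l1 (toR R a)) (l1 (toR R b))) ->
  (forall a, Nstar a -> 0 <= s a) ->
  finite_set [set a | Nstar a /\ s a != 0] ->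
  (0 < \esum_(a in @Nstar d) (s a)%:E)%E ->
  ~ discrete_stationary_injection_solution K gamma p s n.
Proof.
move=> gp c0 Kb s0 sfin spos [n0 nfin neq].
have [a0 [Na0 sa0]] : exists a, Nstar a /\ 0 < s a.
  apply: contrapT => H; move: spos; rewrite esum1 ?ltxx// => a Na.
  have := s0 a Na; rewrite le_eqVlt => /orP[/eqP <-//|sa].
  by exfalso; apply: H; exists a.
pose m (a : 'rV[nat]_d) : R := l1 (toR R a).
(* A radius containing the finite support of [s], started at 1 so that [1 <= L <= rho] holds
   later. *)
pose L := \big[Num.max/1]_(i <- fset_set [set a | Nstar a /\ s a != 0]) m i.
have mL a : Nstar a -> s a != 0 -> m a <= L.
  by move=> Na sa; apply: le_bigmax_seq => //; rewrite in_fset_set// mem_set.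
have L1 : 1 <= L by exact: bigmax_ge_id.
(* The sums run against the counting measure, so the weights absorb the densities [n a]. *)
pose w (a : 'rV[nat]_d) : R := m a `^ (gamma + p) * n a.
have w0 a : Nstar a -> 0 <= w a by move=> Na; rewrite mulr_ge0 ?powR_ge0 ?n0.
have M0 : (0 <= \esum_(a in @Nstar d) (w a)%:E)%E.
  by apply: esum_ge0 => a Na; rewrite lee_fin w0.
have wM : (\esum_(a in @Nstar d) (w a)%:E =
    (fine (\esum_(a in @Nstar d) (w a)%:E))%:E)%E.
  by rewrite fineK// ge0_fin_numE.
move: wM; set M := fine _ => wM; rewrite wM lee_fin in M0.
pose C := c * 3 * 2 `^ (gamma + 2 * p).
have C0 : 0 <= C by rewrite !mulr_ge0 ?powR_ge0.
have e0 : 0 < s a0 / (C * 2 * M + 1) by rewrite divr_gt0// ltr_pwDr// !mulr_ge0.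
have [rho Lrho vsmall] := esum_tail_small _ m w _ L w0 nfin e0.
pose v a := if rho < m a then w a else 0.
have vE' a : v a = tail_weight (gamma + p) rho (m a) * n a.
  by rewrite /v /tail_weight; case: ifP => // _; rewrite mul0r.
have v0 a : Nstar a -> 0 <= v a.
  by move=> Na; rewrite vE' mulr_ge0 ?tail_weight_ge0 ?n0.
have E0 : (0 <= \esum_(a in @Nstar d) (v a)%:E)%E.
  by apply: esum_ge0 => a Na; rewrite lee_fin v0.
have vE : (\esum_(a in @Nstar d) (v a)%:E =
    (fine (\esum_(a in @Nstar d) (v a)%:E))%:E)%E.
  by rewrite fineK// ge0_fin_numE//; apply: le_lt_trans vsmall _; exact: ltry.
have {}vsmall : (\esum_(a in @Nstar d) (v a)%:E <= (s a0 / (C * 2 * M + 1))%:E)%E by [].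
move: vE; set E := fine _ => vE; rewrite vE !lee_fin in E0 vsmall.
have dom := signed_esum_dominated _ w v M E w0 v0 wM vE.
have r1 : 1 <= 2 * rho by lra.
have Lr : L <= 2 * rho by lra.
apply: (@weak_equation_absurd R _ _ (C * 2 * M * E) (s a0)
  (neq _ (C1c_trunc_id d (2 * rho) r1)) _ _ _).
- apply: (dominated_iter _ _ _ _ _ _ C
    (fun b a => (K a b * (trunc_id (2 * rho) (l1 (toR R (a + b)))
       - trunc_id (2 * rho) (l1 (toR R a)) - trunc_id (2 * rho) (l1 (toR R b)))
       * n a * n b)%:E) dom) => //.
  move=> b a Nb Na; rewrite lee_fin toRD l1D -mulrA normrM.
  have nn : 0 <= n a * n b by rewrite mulr_ge0 ?n0.
  rewrite (ger0_norm nn) !vE' /w.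
  have := @coagulation_bound R gamma p c rho (m a) (m b) (K a b) gp _
    (l1_toR_ge1 _ _ Na) (l1_toR_ge1 _ _ Nb) (Kb a b Na Nb).
  move=> /(_ (le_trans L1 Lrho)) /(ler_wpM2r nn) /le_trans; apply.
  by rewrite le_eqVlt; apply/orP; left; apply/eqP; rewrite /C; ring.
- exact: (discrete_source_ge s L).
- by apply: scaled_lt; rewrite ?mulr_ge0.
Qed.

Theorem theorem3p5 (R : realType) (d : nat) (hd : (1 <= d)%N)
    (gamma p : R) (hgp : 1 <= gamma + 2 * p)
    (c1 c2 : R) (hc1 : 0 < c1) (hc12 : c1 <= c2) :
  (forall (K : 'rV[R]_d -> 'rV[R]_d -> R)
      (eta : {measure set (borelRd R d) -> \bar R}) (L : R),
    (forall x y, Rstar x -> Rstar y -> 0 <= K x y) ->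
    {within @Rstar R d `*` @Rstar R d, continuous (fun xy => K xy.1 xy.2)} ->
    (forall x y, Rstar x -> Rstar y -> K x y = K y x) ->
    (forall x y, Rstar x -> Rstar y ->
       c1 * kernel_ref gamma p (l1 x) (l1 y) <= K x y
         <= c2 * kernel_ref gamma p (l1 x) (l1 y)) ->
    bounded_radon_on_Rstar eta ->
    (exists2 A, measurable A & eta A != 0%E) ->
    1 < L ->
    msupport eta `<=` [set x | 1 <= l1 x <= L] ->
    ~ exists f : {measure set (borelRd R d) -> \bar R},
        stationary_injection_solution K gamma p eta f)
  /\
  (forall (K : 'rV[nat]_d -> 'rV[nat]_d -> R) (s : 'rV[nat]_d -> R),
    (forall a b, Nstar a -> Nstar b -> 0 <= K a b) ->
    (forall a b, Nstar a -> Nstar b -> K a b = K b a) ->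
    (forall a b, Nstar a -> Nstar b ->
       c1 * kernel_ref gamma p (l1 (toR R a)) (l1 (toR R b)) <= K a b
         <= c2 * kernel_ref gamma p (l1 (toR R a)) (l1 (toR R b))) ->
    (forall a, Nstar a -> 0 <= s a) ->
    finite_set [set a | Nstar a /\ s a != 0] ->
    (0 < \esum_(a in @Nstar d) (s a)%:E)%E ->
    ~ exists n : 'rV[nat]_d -> R,
        discrete_stationary_injection_solution K gamma p s n).
Proof.
have c20 : 0 <= c2 by lra.
split.
- move=> K eta L K0 _ _ Kb etaR etaA _ supp [f].
  apply: (no_stationary_injection_solution gamma p c2 L K eta f) => // x y Dx Dy.
  by rewrite K0//=; case/andP: (Kb x y Dx Dy).
- move=> K s K0 _ Kb s0 sfin spos [n].
  apply: (no_discrete_stationary_injection_solution gamma p c2 K s n) => // a b Na Nb.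
  by rewrite K0//=; case/andP: (Kb a b Na Nb).
Qed.
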